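(* Let $\varphi:[0,1)\to\mathbb{R}^+$ be non-decreasing and satisfy the Muckenhoupt condition $$\left(\frac 1 t \int_0^t\varphi(y)\,dy\right)\left(\frac 1 t \int_0^t\varphi^{-1/(q-1)}(y)\,dy\right)^{q-1}\leq M\qquad\text{for every } t\in(0,1], \quad ( * )$$ where $q>1$ is fixed and $M\geq 1$ is given. Let $p_0\in(1,q)$ be defined as the solution of the equation $$\frac{q-p_0}{q-1}\,(M\,p_0)^{1/(q-1)} = 1 .$$ Then the following inequality is true for every $t\in(0,1]$ and every $p\in(p_0,q]$: $$\left(\frac 1 t \int_0^t\varphi^{-1/(p-1)}(y)\,dy\right)^{p-1}\left(\frac 1 t \int_0^t\varphi(y)\,dy\right) \;\leq\; \left[\frac{1}{K'}\,c\,\frac q p\left(\frac{p-1}{q-1}\right)^2\right]^{p-1},$$ where $c=M^{1/(q-1)}$ and $K'=K'(p,q,c)=\dfrac{1}{p^{1/(q-1)}}-c\,\dfrac{q-p}{q-1}$. This gives the best possible range of $p$'s for which the Muckenhoupt condition $( * )$ still holds, under the hypothesis of $( * )$.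
   Context: $\mathbb{R}^+$ denotes the positive real numbers. For $r>1$, $\varphi^{-1/(r-1)}(y)$ denotes $(\varphi(y))^{-1/(r-1)}$. *)

(* Defs.v *)
From mathcomp Require Import all_boot all_order all_algebra.
From mathcomp Require Import all_classical all_reals all_analysis.

Set Implicit Arguments.
Unset Strict Implicit.
Unset Printing Implicit Defensive.

Import Order.TTheory GRing.Theory Num.Theory.
Import numFieldNormedType.Exports.

Local Open Scope classical_set_scope.
Local Open Scope ring_scope.

(* A function [0, 1) -> R^+ is encoded as a total function phi : R -> R of
   which only the values on [0, 1[ are constrained or used. *)
Definition nondecreasing_weight (R : realType) (phi : R -> R) : Prop :=
  {in `[0, 1[, forall y, 0 < phi y} /\
  {in `[0, 1[ &, {homo phi : x y / x <= y}}.

(* The mean takes values in [0, +oo] on nonnegative functions: phi may be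
   unbounded near 1, so its mean over [0, 1[ is possibly infinite. *)
Definition mean (R : realType) (f : R -> R) (t : R) : \bar R :=
  ((t^-1)%:E * \int[lebesgue_measure]_(y in `[0%R, t[) (f y)%:E)%E.

Definition muckenhoupt_product (R : realType) (p : R) (phi : R -> R) (t : R)
    : \bar R :=
  (mean phi t * mean (fun y => phi y `^ (- (1 / (p - 1))))%R t `^ (p - 1))%E.

(* The bound C%:E is finite, so it forces the means to be finite: both are
   positive when phi is positive on [0, 1[ and 0 < t <= 1. *)
Definition muckenhoupt (R : realType) (p C : R) (phi : R -> R) : Prop :=
  forall t, 0 < t <= 1 -> (muckenhoupt_product p phi t <= C%:E)%E.

(* 0 < Kprime p q c holds for p0 < p <= q, with p0 as in the theorem. *)
Definition Kprime (R : realType) (p q c : R) : R :=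
  1 / p `^ (1 / (q - 1)) - c * ((q - p) / (q - 1)).

(* Main.v *)
Require Import Defs.
From mathcomp Require Import all_boot all_order all_algebra.
From mathcomp Require Import all_classical all_reals all_analysis.
From mathcomp Require Import measurable_realfun ring lra.

Set Implicit Arguments.
Unset Strict Implicit.
Unset Printing Implicit Defensive.

Import Order.TTheory GRing.Theory Num.Theory.
Import numFieldNormedType.Exports.

Local Open Scope classical_set_scope.
Local Open Scope ring_scope.

(** Write b = 1/(q-1), a = 1/(p-1), k = a - b, c = M^b, and let U(t) be the mean
    of phi over [0, t[ and L(t) the integral of phi^-b over [0, t[.  The
    Muckenhoupt condition says that L(t) <= c t U(t)^-b.  The bound comes from a
    monotone quantity: with a suitable constant lam,
      D(t) = L(t) U(t)^-k - lam t U(t)^-a - K' int_0^t phi^-a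
    is nondecreasing and tends to 0 at 0, so that D(t) >= 0, which implies
      K' int_0^t phi^-a <= (c - lam) t U(t)^-a;
    the constant of the theorem is then obtained from K' >= 0.

    For smooth phi, one checks D' >= 0 with x = phi/U >= 1, using t U' = phi - U
    and the tangent of the convex function x^-b at x = p, which is the value of
    phi/U for the weight t^(p-1).  A monotone phi need not be continuous, so the
    derivative is replaced by increments: [mean_step] is an exact inequality
    between the values at s and t, obtained from convexity alone, and it gives
    D(t) - D(s) >= - p^-b (t - s) (Psi(t) - Psi(s)) for the nondecreasing
    Psi = - U^-a.  Summed over a uniform mesh the right-hand sides telescope and
    vanish as the mesh is refined ([increments_le]).  All the integrals of
    negative powers are finite, because phi >= phi 0 > 0; this is used only
    qualitatively, and the value of phi 0 disappears from the final bound.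

    The constant K' is positive precisely because p > p0 ([Kprime_gt0]).  The
    exponent p0 is read off the weight y^(p0-1): it satisfies the q-condition with
    constant exactly M, while its power y^(-(p0-1)/(p-1)) >= y^-1 is not integrable
    at 0 when p <= p0.  The truncations max(y, e)^(p0-1) are positive at 0, still
    satisfy the q-condition with constant M ([max_powR_muckenhoupt]), and their
    p-constants blow up as e tends to 0 ([max_powR_not_muckenhoupt]). *)

(** * Inequalities for real powers *)

Lemma powRN_le (R : realType) (r x y : R) : 0 <= r -> 0 < x -> x <= y ->
  y `^ (- r) <= x `^ (- r).
Proof.
move=> r0 x0 xy; have y0 := lt_le_trans x0 xy.
by rewrite !powRN lef_pV2 ?posrE ?powR_gt0// ge0_ler_powR// ?nnegrE ltW.
Qed.

(** Convexity of x^-b: its graph lies above the tangent at z. *)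
Lemma powR_tangent (R : realType) (b x z : R) : 0 <= b -> 0 < x -> 0 < z ->
  z `^ (- b) * (1 + b - b * (x / z)) <= x `^ (- b).
Proof.
move=> b0 x0 z0; have w0 : 0 < x / z by rewrite divr_gt0.
have -> : x `^ (- b) = z `^ (- b) * (x / z) `^ (- b).
  by rewrite -powRM ?(ltW w0) ?(ltW z0)// mulrC divfK// gt_eqF.
rewrite ler_wpM2l ?powR_ge0// /powR gt_eqF//.
apply: le_trans (expR_ge1Dx _).
have : ln (x / z) <= x / z - 1.
  by rewrite -{1}(subrK 1 (x / z)) addrC le_ln1Dx// ltrBrDr addNr.
by move=> /(ler_wpM2l b0); lra.
Qed.

(** Weighted arithmetic-geometric means: both V^-(k+b) and U^-(k+b) are compared
    with U^-b V^-k, through 1 + x <= exp x. *)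
Lemma powR_diff_le (R : realType) (b k U V : R) : 0 <= b -> 0 <= k ->
  0 < V -> 0 < U ->
  (k + b) * (U `^ (- b) * (V `^ (- k) - U `^ (- k))) <=
  k * (V `^ (- (k + b)) - U `^ (- (k + b))).
Proof.
move=> b0 k0 V0 U0.
have V1 : V != 0 by rewrite gt_eqF.
have U1 : U != 0 by rewrite gt_eqF.
rewrite !opprD !powRD ?V1 ?U1 ?implybT//.
rewrite /powR (negbTE V1) (negbTE U1) -!expRD.
set u := ln U; set v := ln V.
have h1 : expR (- k * v - b * u) * (1 + (b * u - b * v)) <= expR (- k * v + - b * v).
  rewrite (_ : - k * v + - b * v = (- k * v - b * u) + (b * u - b * v)); last by ring.
  by rewrite [leRHS]expRD ler_wpM2l ?expR_ge0// expR_ge1Dx.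
have h2 : expR (- k * v - b * u) * (1 + (k * v - k * u)) <= expR (- k * u + - b * u).
  rewrite (_ : - k * u + - b * u = (- k * v - b * u) + (k * v - k * u)); last by ring.
  by rewrite [leRHS]expRD ler_wpM2l ?expR_ge0// expR_ge1Dx.
have := ler_wpM2l k0 h1; have := ler_wpM2l b0 h2.
rewrite mulrBr mulrBr -!expRD.
rewrite (addrC (- b * u)) (addrC (- b * u)) !mulNr.
set e := expR (- (k * v) - b * u); set f := expR _; set g := expR _.
nra.
Qed.

(** The product for max(y, e)^al at t > e is the one for y^al times this factor,
    with u = e/t.  The two terms are bounded by exp (al y) and exp (- al y), where
    y = u^(1 - al/(q-1)) dominates u^(al + 1). *)
Lemma truncation_factor_le1 (R : realType) (al q u : R) :
  1 < q -> 0 <= al -> al < q - 1 -> 0 < u <= 1 ->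
  (1 + al * u `^ (al + 1)) *
  (1 - al / (q - 1) * u `^ (1 - al / (q - 1))) `^ (q - 1) <= 1.
Proof.
move=> q1 al0 alq u01; have q10 : 0 < q - 1 by lra.
set g := al / (q - 1).
have g0 : 0 <= g by rewrite divr_ge0// ltW.
have g1 : g < 1 by rewrite ltr_pdivrMr// mul1r.
have xy : u `^ (al + 1) <= u `^ (1 - g) by apply: ger_powR => //; lra.
have y1 : u `^ (1 - g) <= 1.
  by rewrite -[leRHS](powRr0 u) ger_powR//; lra.
move: xy y1 (powR_ge0 u (1 - g)) (powR_ge0 u (al + 1)).
move: (u `^ (1 - g)) (u `^ (al + 1)) => y x xy y1 y0 x0.
have h1 : 1 + al * x <= expR (al * y).
  by apply: le_trans (expR_ge1Dx _) _; rewrite ler_expR ler_wpM2l.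
have h2 : (1 - g * y) `^ (q - 1) <= expR (- (al * y)).
  rewrite (_ : - (al * y) = - (g * y) * (q - 1)); last by rewrite /g; field; rewrite gt_eqF.
  rewrite expRM ge0_ler_powR ?nnegrE ?expR_ge0 ?(ltW q10) ?expR_ge1Dx//.
  by rewrite subr_ge0; nra.
apply: le_trans (ler_pM _ _ h1 h2) _; first by rewrite addr_ge0// mulr_ge0.
  exact: powR_ge0.
by rewrite -expRD subrr expR0.
Qed.

(** * Monotonicity from small increments *)

(** On a uniform mesh with n steps the errors telescope to
    C ((y - x)/n) (Psi y - Psi x), which tends to 0. *)
Lemma increments_le (R : realType) (D Psi : R -> R) (C x y : R) : x <= y ->
  (forall s t, x <= s -> s <= t -> t <= y ->
    - (C * (t - s) * (Psi t - Psi s)) <= D t - D s) ->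
  D x <= D y.
Proof.
move=> xy incr.
have mesh n : (0 < n)%N -> - (C * (y - x) * (Psi y - Psi x)) <= (D y - D x) * n%:R.
  move=> n0; have nR : (0 : R) < n%:R by rewrite ltr0n.
  pose d := (y - x) / n%:R; pose t i := x + i%:R * d.
  have d0 : 0 <= d by rewrite divr_ge0 ?subr_ge0// ltW.
  have t0 : t 0%N = x by rewrite /t mul0r addr0.
  have tn : t n = y by rewrite /t /d mulrC divfK ?gt_eqF//; ring.
  have tS i : t i.+1 - t i = d by rewrite /t -natr1; ring.
  have : \sum_(0 <= i < n) - (C * d * (Psi (t i.+1) - Psi (t i)))
      <= \sum_(0 <= i < n) (D (t i.+1) - D (t i)).
    rewrite !big_nat; apply: ler_sum => i /andP[_ iltn].
    have := incr (t i) (t i.+1); rewrite tS; apply.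
    - by rewrite /t lerDl mulr_ge0.
    - by rewrite -subr_ge0 tS.
    - by rewrite -tn /t lerD2l ler_wpM2r// ler_nat.
  rewrite sumrN -mulr_sumr (telescope_sumr (Psi \o t)) ?(telescope_sumr (D \o t))//=.
  rewrite t0 tn -(ler_pM2r nR); apply: le_trans.
  by rewrite /d le_eqVlt; apply/orP/or_introl/eqP; field; rewrite gt_eqF.
rewrite leNgt; apply/negP => Dlt.
have e0 : 0 < D x - D y by rewrite subr_gt0.
set K := C * (y - x) * (Psi y - Psi x) in mesh.
have := truncnS_gt (K / (D x - D y)); rewrite ltr_pdivrMr// => Kn.
by have := mesh _ (ltn0Sn (Num.truncn (K / (D x - D y)))); lra.
Qed.

(** * Integrals over half-open intervals *)

Section interval_integrals.
Variable R : realType.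
Implicit Types (f : R -> R) (x y s t m : R).
Local Notation mu := (@lebesgue_measure R).

Lemma lebesgue_measure_itvco x y : x <= y -> mu `[x, y[ = (y - x)%:E.
Proof.
move=> xy; rewrite lebesgue_measure_itv/= lte_fin.
have [//|yx] := ltP x y.
by rewrite (_ : y - x = 0)//; apply/eqP; rewrite subr_eq0 eq_le xy yx.
Qed.

Lemma bounded_integrable f x y m : measurable_fun `[x, y[ f ->
  (forall z, x <= z < y -> `|f z| <= m) -> mu.-integrable `[x, y[ (EFin \o f).
Proof.
move=> mf fm; apply: measurable_bounded_integrable => //.
  by rewrite /= lebesgue_measure_itv/=; case: ifP => // _; rewrite -EFinD ltry.
exists m; split; first exact: num_real.
by move=> M mM z /=; rewrite in_itv/= => /fm fz; apply: le_trans fz (ltW mM).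
Qed.

Lemma integrable_itv_sub f x y s t : x <= s -> t <= y ->
  mu.-integrable `[x, y[ (EFin \o f) -> mu.-integrable `[s, t[ (EFin \o f).
Proof.
move=> xs ty; apply: integrableS => // z /=; rewrite !in_itv/= => /andP[sz zt].
by rewrite (le_trans xs)//= (lt_le_trans zt).
Qed.

Lemma Rintegral_itv_split f x s t : x <= s -> s <= t ->
  mu.-integrable `[x, t[ (EFin \o f) ->
  \int[mu]_(z in `[x, t[) f z = \int[mu]_(z in `[x, s[) f z + \int[mu]_(z in `[s, t[) f z.
Proof.
move=> xs st; rewrite (@itv_bndbnd_setU _ _ _ (BLeft s)) ?bnd_simp// => fi.
rewrite Rintegral_setU//; apply/disj_setPS => z [/=].
by rewrite !in_itv/= => /andP[_ zs] /andP[]; rewrite leNgt zs.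
Qed.

Lemma Rintegral_itv_cst x y m : x <= y -> \int[mu]_(_ in `[x, y[) m = m * (y - x).
Proof. by move=> xy; rewrite Rintegral_cst//= lebesgue_measure_itvco. Qed.

Lemma integrable_itv_cst x y m : mu.-integrable `[x, y[ (EFin \o cst m).
Proof. by apply: (@bounded_integrable _ _ _ `|m|). Qed.

Lemma Rintegral_itv_le f x y m : x <= y -> mu.-integrable `[x, y[ (EFin \o f) ->
  (forall z, x <= z < y -> f z <= m) -> \int[mu]_(z in `[x, y[) f z <= m * (y - x).
Proof.
move=> xy fi fm; rewrite -Rintegral_itv_cst//; apply: le_Rintegral => //; exact: integrable_itv_cst.
Qed.

Lemma Rintegral_itv_ge f x y m : x <= y -> mu.-integrable `[x, y[ (EFin \o f) ->
  (forall z, x <= z < y -> m <= f z) -> m * (y - x) <= \int[mu]_(z in `[x, y[) f z.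
Proof.
move=> xy fi fm; rewrite -Rintegral_itv_cst//; apply: le_Rintegral => //; exact: integrable_itv_cst.
Qed.

Lemma muckenhoupt_productE p f t :
  mu.-integrable `[0, t[ (EFin \o f) ->
  mu.-integrable `[0, t[ (EFin \o (fun y => f y `^ (- (1 / (p - 1))))) ->
  muckenhoupt_product p f t =
  (t^-1 * (\int[mu]_(y in `[0%R, t[) f y) *
   (t^-1 * \int[mu]_(y in `[0%R, t[) f y `^ (- (1 / (p - 1)))) `^ (p - 1))%:E.
Proof.
move=> fi gi; rewrite /muckenhoupt_product /mean.
have -> : (\int[mu]_(y in `[0%R, t[) (f y)%:E)%E = (\int[mu]_(y in `[0%R, t[) f y)%:E.
  by rewrite fineK//; exact: integrable_fin_num fi.
have -> : (\int[mu]_(y in `[0%R, t[) (f y `^ (- (1 / (p - 1))))%:E)%E =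
    (\int[mu]_(y in `[0%R, t[) f y `^ (- (1 / (p - 1))))%:E.
  by rewrite fineK//; exact: integrable_fin_num gi.
by [].
Qed.

Lemma nondecreasing_in_measurable f x y :
  {in `[x, y[ &, {homo f : u v / u <= v}} -> measurable_fun `[x, y[ f.
Proof.
move=> f_nd mD.
apply: (measurability (@RGenCInfty.G R)) => //.
  exact: RGenCInfty.measurableE.
move=> _ /= [_ [r] -> <-].
apply: is_interval_measurable => s t/= [sD fs] [tD ft] u /andP[su ut].
have uD : u \in `[x, y[.
  move: sD tD; rewrite !in_itv/= => /andP[xs _] /andP[_ ty].
  by rewrite (le_trans xs)//= (le_lt_trans ut).
split=> //=; rewrite !in_itv/= !andbT in fs ft *.
by rewrite (le_trans fs)// f_nd.
Qed.

End interval_integrals.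

(** * Nondecreasing weights *)

Section weights.
Variable R : realType.
Implicit Types (phi : R -> R) (t r : R).
Local Notation mu := (@lebesgue_measure R).

Lemma weight_gt0 phi y : nondecreasing_weight phi -> 0 <= y < 1 -> 0 < phi y.
Proof. by move=> [pos _] y01; apply: pos; rewrite in_itv. Qed.

Lemma weight_le phi x y : nondecreasing_weight phi -> 0 <= x -> x <= y -> y < 1 ->
  phi x <= phi y.
Proof.
move=> [_ nd] x0 xy y1; apply: nd => //; rewrite in_itv/= ?x0 ?(le_trans x0)//.
exact: le_lt_trans y1.
Qed.

Lemma weight_measurable phi : nondecreasing_weight phi ->
  measurable_fun `[(0 : R), 1[ phi.
Proof. by move=> [_ nd]; exact: nondecreasing_in_measurable. Qed.

Lemma weight_powRN_integrable phi r t : nondecreasing_weight phi -> 0 <= r -> t <= 1 ->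
  mu.-integrable `[0, t[ (EFin \o (fun y => phi y `^ (- r))).
Proof.
move=> w r0 t1; apply: (@integrable_itv_sub _ _ 0 1) => //.
apply: (@bounded_integrable _ _ _ _ (phi 0 `^ (- r))).
  by apply: (measurableT_comp (measurable_powR (- r))); exact: weight_measurable.
move=> z /andP[z0 z1]; rewrite ger0_norm ?powR_ge0//.
by rewrite powRN_le ?weight_le ?weight_gt0// lexx ltr01.
Qed.

Lemma weight_mean_gt0 phi t : nondecreasing_weight phi -> 0 < t <= 1 ->
  mu.-integrable `[0, t[ (EFin \o phi) ->
  0 < t^-1 * \int[mu]_(y in `[0, t[) phi y.
Proof.
move=> w /andP[t0 t1] fi; rewrite mulr_gt0 ?invr_gt0//.
apply: (@lt_le_trans _ _ (phi 0 * (t - 0))).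
  by rewrite subr0 mulr_gt0// weight_gt0 ?lexx ?ltr01.
apply: Rintegral_itv_ge => //; first exact: ltW.
by move=> z /andP[z0 zt]; rewrite weight_le// (lt_le_trans zt).
Qed.

(** Since phi^(-1/(q-1)) has a positive integral, an infinite mean of phi would
    make the product infinite. *)
Lemma muckenhoupt_integrable phi q M t : nondecreasing_weight phi -> 1 < q ->
  muckenhoupt q M phi -> 0 < t <= 1 -> mu.-integrable `[0, t[ (EFin \o phi).
Proof.
move=> w q1 muck /andP[t0 t1].
have b0 : 0 <= 1 / (q - 1) by rewrite divr_ge0// subr_ge0 ltW.
have sub z : 0 <= z < t -> 0 <= z < 1.
  by move=> /andP[-> zt]; rewrite (lt_le_trans zt).
have mphi : measurable_fun `[0, t[ phi.
  by apply: measurable_funS (weight_measurable w).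
have hi := weight_powRN_integrable w b0 t1.
set h := fun y => phi y `^ (- (1 / (q - 1))) in hi.
have hpos : 0 < \int[mu]_(y in `[0, t[) h y.
  have t20 : 0 <= t / 2 by rewrite divr_ge0 ?ltW.
  have t2t : t / 2 <= t by rewrite ler_pdivrMr//; lra.
  have t21 : 0 <= t / 2 < 1 by apply: sub; rewrite t20/= ltr_pdivrMr//; lra.
  rewrite (@Rintegral_itv_split _ _ _ (t / 2))//.
  apply: (@lt_le_trans _ _ (h (t / 2) * (t / 2 - 0))).
    by rewrite subr0 mulr_gt0 ?divr_gt0//; apply/powR_gt0/weight_gt0.
  rewrite -[leLHS]addr0 lerD//; last by apply: Rintegral_ge0 => z _; exact: powR_ge0.
  apply: Rintegral_itv_ge => //; first exact: integrable_itv_sub hi.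
  move: t21 => /andP[_ t21] z /andP[z0 zt]; have zt1 := lt_trans zt t21.
  apply: powRN_le => //; first by apply: weight_gt0 => //; rewrite z0.
  by apply: weight_le => //; exact: ltW.
apply/integrableP; split; first exact/measurable_EFinP.
have -> : (\int[mu]_(x in `[0%R, t[) `|(EFin \o phi) x| = \int[mu]_(x in `[0%R, t[) (phi x)%:E)%E.
  apply: eq_integral => z; rewrite inE/= in_itv/= => /sub zt.
  by rewrite ger0_norm// ltW// weight_gt0.
rewrite ltey; apply/eqP => phioo.
have := muck t; rewrite t0 t1 => /(_ isT); rewrite /muckenhoupt_product /mean phioo.
have -> : (\int[mu]_(y in `[0%R, t[) (phi y `^ (- (1 / (q - 1))))%:E)%E =
    (\int[mu]_(y in `[0%R, t[) h y)%:E.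
  by rewrite fineK//; exact: integrable_fin_num hi.
rewrite gt0_muley ?lte_fin ?invr_gt0// gt0_mulye ?leye_eq//.
by rewrite poweR_gt0// -EFinM lte_fin mulr_gt0 ?invr_gt0.
Qed.

(** The Muckenhoupt condition raised to the power 1/(q-1). *)
Lemma muckenhoupt_mean_le phi q M t : nondecreasing_weight phi -> 1 < q -> 0 <= M ->
  muckenhoupt q M phi -> 0 < t <= 1 ->
  \int[mu]_(y in `[0, t[) phi y `^ (- (1 / (q - 1))) <=
  M `^ (1 / (q - 1)) * t * (t^-1 * \int[mu]_(y in `[0, t[) phi y) `^ (- (1 / (q - 1))).
Proof.
move=> w q1 M0 muck t01; have /andP[t0 t1] := t01.
have b0 : 0 <= 1 / (q - 1) by rewrite divr_ge0// subr_ge0 ltW.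
have fi := muckenhoupt_integrable w q1 muck t01.
have hi := weight_powRN_integrable w b0 t1.
have U0 := weight_mean_gt0 w t01 fi.
have L0 : 0 <= \int[mu]_(y in `[0, t[) phi y `^ (- (1 / (q - 1))).
  by apply: Rintegral_ge0 => z _; exact: powR_ge0.
have := muck t t01; rewrite muckenhoupt_productE// lee_fin.
move: U0 L0; set U := t^-1 * _; set L := Rintegral _ _ _ => U0 L0.
rewrite mulrC -ler_pdivlMr// => le1.
have X0 : 0 <= t^-1 * L by rewrite mulr_ge0// invr_ge0 ltW.
have := @ge0_ler_powR _ (1 / (q - 1)) b0 _ _ _ _ le1.
rewrite !nnegrE powR_ge0 divr_ge0 ?(ltW U0)// => /(_ isT isT).
rewrite -powRrM (_ : (q - 1) * (1 / (q - 1)) = 1); last by field; lra.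
rewrite powRr1// powRM ?invr_ge0 ?(ltW U0)// -(powR_inv1 (ltW U0)) -powRrM mulN1r.
by rewrite mulrC ler_pdivrMr// mulrAC.
Qed.

End weights.

(** * The integral of a negative power of the weight *)

(** The discrete form of the differential inequality satisfied by
    L U^-k - lam t U^-a.  Here U and V are the means of phi over [0, t[ and
    [0, s[, and L and l the integrals of phi^-b over the same intervals; the last
    hypothesis is the tangent inequality at p U integrated over [s, t[. *)
Lemma mean_step (R : realType) (b k p c s t U V l L lam : R) :
  lam = (b * (p `^ (- b) / p) + k * c) / (k + b) ->
  0 <= b -> 0 <= k -> 0 <= c -> 1 < p -> (k + b) * (p - 1) = 1 -> 0 <= s <= t ->
  0 < V -> 0 < U -> V <= U -> l <= L -> L <= c * t * U `^ (- b) ->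
  p `^ (- b) * U `^ (- b) * ((t - s) * (1 + b) - b * ((t * U - s * V) / (p * U)))
    <= L - l ->
  (t - s) * (p `^ (- b) * U `^ (- (k + b)) - c * (k / (k + b)) * V `^ (- (k + b)))
  <= (L * U `^ (- k) - lam * (t * U `^ (- (k + b))))
     - (l * V `^ (- k) - lam * (s * V `^ (- (k + b)))).
Proof.
move=> lamE b0 k0 c0 p1 ap /andP[s0 st] V0 U0 VU lL Lc Ll.
have a0 : 0 < k + b by nra.
have diff := powR_diff_le b0 k0 V0 U0.
have tang := powR_tangent (ltW a0) V0 U0.
have kVU : U `^ (- k) <= V `^ (- k). by exact: powRN_le.
have AE : U `^ (- (k + b)) = U `^ (- k) * U `^ (- b).
  by rewrite opprD powRD// (gt_eqF U0) implybT.
have pi0 := powR_ge0 p (- b).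
have ku0 := powR_ge0 U (- k).
move: lamE (powR_ge0 U (- b)) AE diff tang kVU pi0 ku0 Lc Ll.
set A := U `^ (- (k + b)); set B := V `^ (- (k + b)); set pi := p `^ (- b).
set bu := U `^ (- b); set ku := U `^ (- k); set kv := V `^ (- k).
move=> lamE bu0 AE diff tang kVU pi0 ku0 Lc Ll.
(* Discrete product rule: L ku - l kv = (L - l) kv - L (kv - ku).  ineq1 bounds
   the first term from below, ineq2 the second one from above. *)
have ineq1 : pi * A * ((t - s) * (1 + b) - b * ((t * U - s * V) / (p * U)))
    <= (L - l) * kv.
  apply: (@le_trans _ _ ((L - l) * ku)); last by rewrite ler_wpM2l// subr_ge0.
  by have := ler_wpM2r ku0 Ll; rewrite AE; apply: le_trans; lra.
have ineq2 : (k + b) * (L * (kv - ku)) <= c * t * (k * (B - A)).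
  apply: le_trans (ler_wpM2l _ diff); last by rewrite mulr_ge0//; lra.
  have h : 0 <= (k + b) * (kv - ku) by rewrite mulr_ge0 ?(ltW a0)// subr_ge0.
  by have := ler_wpM2l h Lc; lra.
set X := V / U in tang.
have XE : (t * U - s * V) / (p * U) = (t - s * X) / p.
  by rewrite /X; field; rewrite !gt_eqF//; lra.
have pE : p = (k + b + 1) / (k + b).
  by apply/(@mulfI _ (k + b)); rewrite ?gt_eqF// mulrCA divff ?gt_eqF//; lra.
have p0 : 0 < p by lra.
(* Joint convexity of (t, G) |-> t^(1+a) G^-a, a = k + b: the increment of
   t U^-a is at most the gradient at the right end point. *)
have main : 0 <= (b * pi / (p * (k + b))) * (s * (B - A * (1 + (k + b) - (k + b) * X))).
  apply: mulr_ge0; first by rewrite divr_ge0 ?mulr_ge0// ltW.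
  by rewrite mulr_ge0// subr_ge0.
have ineq3 : L * (kv - ku) <= c * t * (k * (B - A)) / (k + b).
  by rewrite ler_pdivlMr// mulrC.
rewrite -subr_ge0; apply: le_trans main _.
rewrite XE in ineq1.
suff -> : b * pi / (p * (k + b)) * (s * (B - A * (1 + (k + b) - (k + b) * X))) =
  pi * A * ((t - s) * (1 + b) - b * ((t - s * X) / p))
  - c * t * (k * (B - A)) / (k + b)
  - lam * (t * A) + lam * (s * B) - (t - s) * (pi * A - c * (k / (k + b)) * B).
  by lra.
rewrite lamE pE; field.
by rewrite !gt_eqF//; lra.
Qed.

Section main_bound.
Variable R : realType.
Implicit Types (phi : R -> R).
Local Notation mu := (@lebesgue_measure R).

(** The function D below is nondecreasing on ]0, T] by [mean_step], and
    D(s) >= - E s for a constant E depending on phi 0; hence D(T) >= 0. *)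
Lemma integral_powRN_bound phi (b k c p T : R) : nondecreasing_weight phi ->
  0 <= b -> 0 <= k -> 0 <= c -> 1 < p -> (k + b) * (p - 1) = 1 ->
  0 < T <= 1 -> mu.-integrable `[0, T[ (EFin \o phi) ->
  (forall t, 0 < t <= T -> \int[mu]_(y in `[0, t[) phi y `^ (- b) <=
    c * t * (t^-1 * \int[mu]_(y in `[0, t[) phi y) `^ (- b)) ->
  let K := p `^ (- b) - c * (k / (k + b)) in
  0 <= K ->
  K * \int[mu]_(y in `[0, T[) phi y `^ (- (k + b)) <=
  (c - (b * (p `^ (- b) / p) + k * c) / (k + b)) *
  (T * (T^-1 * \int[mu]_(y in `[0, T[) phi y) `^ (- (k + b))).
Proof.
move=> w b0 k0 c0 p1 ap /andP[T0 T1] fi H /= K0.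
have a0 : 0 < k + b by nra.
have p0 : 0 < p by lra.
pose U t := t^-1 * \int[mu]_(y in `[0, t[) phi y.
pose L t := \int[mu]_(y in `[0, t[) phi y `^ (- b).
pose J t := \int[mu]_(y in `[0, t[) phi y `^ (- (k + b)).
have {}H t : 0 < t <= T -> L t <= c * t * U t `^ (- b) by exact: H.
rewrite -/(U T) -/(J T).
have UE t : U t = t^-1 * \int[mu]_(y in `[0, t[) phi y by [].
have LE t : L t = \int[mu]_(y in `[0, t[) phi y `^ (- b) by [].
have JE t : J t = \int[mu]_(y in `[0, t[) phi y `^ (- (k + b)) by [].
(* From here on U, L, J and D are known through their equations only. *)
move: U L J H UE LE JE => U L J H UE LE JE.
move KE : (p `^ (- b) - _) K0 => K K0.
move lamE : ((b * _ + _) / _) => lam.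
have [D DE] : exists D : R -> R, forall t,
    D t = L t * U t `^ (- k) - lam * (t * U t `^ (- (k + b))) - K * J t.
  by exists (fun t => L t * U t `^ (- k) - lam * (t * U t `^ (- (k + b))) - K * J t).
have lam0 : 0 <= lam.
  by rewrite -lamE divr_ge0 ?(ltW a0)// addr_ge0 ?mulr_ge0// ?invr_ge0 ?powR_ge0 ?(ltW p0).
have phi00 : 0 < phi 0 by rewrite weight_gt0 ?lexx ?ltr01.
have fit t : t <= T -> mu.-integrable `[0, t[ (EFin \o phi).
  by move=> tT; exact: integrable_itv_sub fi.
have tU t : 0 < t -> t * U t = \int[mu]_(y in `[0, t[) phi y.
  by move=> t0; rewrite UE mulrA divff ?mul1r// gt_eqF.
have Uge t : 0 < t <= T -> phi 0 <= U t.
  move=> /andP[t0 tT]; rewrite -(ler_pM2l t0) tU// mulrC -[X in _ * X]subr0.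
  apply: Rintegral_itv_ge; [exact: ltW|exact: fit|] => z /andP[z0 zt].
  by rewrite weight_le// (lt_le_trans zt)// (le_trans tT).
have Ule s : 0 < s <= T -> s < 1 -> U s <= phi s.
  move=> /andP[s0 sT] s1; rewrite -(ler_pM2l s0) tU// mulrC -[X in _ * X]subr0.
  apply: Rintegral_itv_le; [exact: ltW|exact: fit|] => z /andP[z0 zs].
  by rewrite weight_le// ltW.
have incr s t : 0 < s -> s <= t -> t <= T ->
    - (p `^ (- b) * (t - s) * (U s `^ (- (k + b)) - U t `^ (- (k + b)))) <= D t - D s.
  move=> s0; rewrite le_eqVlt => /predU1P[<- _|st tT].
    by rewrite !subrr !mulr0 oppr0.
  have t0 := lt_trans s0 st; have t1 := le_trans tT T1; have s1 := lt_le_trans st t1.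
  have sT := le_trans (ltW st) tT.
  have st0 : 0 < t - s by rewrite subr_gt0.
  have range z : s <= z < t -> [/\ 0 <= z, s <= z & z < 1].
    by move=> /andP[sz zt]; rewrite sz (le_trans (ltW s0))// (lt_le_trans zt).
  have Us : 0 < U s by rewrite (lt_le_trans phi00)// Uge// s0.
  have Ut : 0 < U t by rewrite (lt_le_trans phi00)// Uge// t0.
  have split := Rintegral_itv_split (ltW s0) (ltW st) (fit _ tT).
  rewrite -!tU// in split.
  have fist : mu.-integrable `[s, t[ (EFin \o phi).
    by apply: integrable_itv_sub (fit _ tT) => //; exact: ltW.
  have VU : U s <= U t.
    have : phi s * (t - s) <= \int[mu]_(y in `[s, t[) phi y.
      apply: Rintegral_itv_ge => //; first exact: ltW.
      by move=> z /range[z0 sz z1]; rewrite weight_le// ltW.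
    have : U s * (t - s) <= phi s * (t - s).
      by rewrite ler_wpM2r ?(ltW st0)// Ule// s0.
    by move=> h1 h2; rewrite -(ler_pM2l t0) split; lra.
  have hi := weight_powRN_integrable w b0 t1.
  have hist : mu.-integrable `[s, t[ (EFin \o (fun y => phi y `^ (- b))).
    by apply: integrable_itv_sub hi => //; exact: ltW.
  have Lsplit : L t - L s = \int[mu]_(y in `[s, t[) phi y `^ (- b).
    by rewrite !LE (Rintegral_itv_split (ltW s0) (ltW st) hi) addrC addKr.
  have gi := weight_powRN_integrable w (ltW a0) t1.
  have gist : mu.-integrable `[s, t[ (EFin \o (fun y => phi y `^ (- (k + b)))).
    by apply: integrable_itv_sub gi => //; exact: ltW.
  have Jle : J t - J s <= U s `^ (- (k + b)) * (t - s).
    rewrite !JE (Rintegral_itv_split (ltW s0) (ltW st) gi) addrC addKr.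
    apply: Rintegral_itv_le => //; first exact: ltW.
    move=> z /range[z0 sz z1]; apply: powRN_le => //; first exact: ltW.
    by apply: le_trans (weight_le w (ltW s0) sz z1); rewrite Ule ?s0.
  have Lle : L s <= L t.
    by rewrite -subr_ge0 Lsplit; apply: Rintegral_ge0 => z _; exact: powR_ge0.
  have Ltang : p `^ (- b) * U t `^ (- b) *
      ((t - s) * (1 + b) - b * ((t * U t - s * U s) / (p * U t))) <= L t - L s.
    have z0 : 0 < p * U t by rewrite mulr_gt0.
    rewrite Lsplit -powRM ?(ltW p0) ?(ltW Ut)//.
    set z := p * U t in z0 *.
    pose m1 := z `^ (- b) * (1 + b); pose m2 := - (z `^ (- b) * (b / z)).
    have mi : mu.-integrable `[s, t[ (EFin \o (fun y => m2 * phi y)).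
      rewrite (_ : _ \o _ = (fun y => m2%:E * (EFin \o phi) y)%E).
        exact: integrableZl.
      by apply/funext => y /=; rewrite EFinM.
    have ci := integrable_itv_cst s t m1.
    have : \int[mu]_(y in `[s, t[) (m1 + m2 * phi y) <=
        \int[mu]_(y in `[s, t[) phi y `^ (- b).
      apply: le_Rintegral => //.
        rewrite (_ : _ \o _ = (EFin \o cst m1) \+ (EFin \o (fun y => m2 * phi y))).
          exact: integrableD.
        by apply/funext => y /=; rewrite EFinD.
      move=> y /=; rewrite in_itv/= => /range[y0 sy y1].
      have := powR_tangent b0 (weight_gt0 w (introT andP (conj y0 y1))) z0.
      by apply: le_trans; rewrite le_eqVlt; apply/orP/or_introl/eqP; rewrite /m1 /m2; ring.
    rewrite (RintegralD _ ci mi)//= (RintegralZl m2 _ fist)// Rintegral_itv_cst ?(ltW st)//.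
    apply: le_trans; rewrite split le_eqVlt; apply/orP/or_introl/eqP.
    by rewrite /m1 /m2; ring.
  have step : (t - s) * (p `^ (- b) * U t `^ (- (k + b))
        - c * (k / (k + b)) * U s `^ (- (k + b))) <=
      (L t * U t `^ (- k) - lam * (t * U t `^ (- (k + b)))) -
      (L s * U s `^ (- k) - lam * (s * U s `^ (- (k + b)))).
    apply: (mean_step (esym lamE) b0 k0 c0 p1 ap _ Us Ut VU Lle _ Ltang).
      by rewrite (ltW s0) ltW.
    by apply: H; rewrite t0.
  have -> : D t - D s = (L t * U t `^ (- k) - lam * (t * U t `^ (- (k + b)))) -
      (L s * U s `^ (- k) - lam * (s * U s `^ (- (k + b)))) - K * (J t - J s).
    by rewrite !DE; ring.
  apply: le_trans (lerB step (ler_wpM2l K0 Jle)).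
  by rewrite -KE le_eqVlt; apply/orP/or_introl/eqP; ring.
have DT : 0 <= D T.
  have E0 : 0 <= (lam + K) * phi 0 `^ (- (k + b)) by rewrite mulr_ge0 ?powR_ge0// addr_ge0.
  set E := _ * _ in E0.
  apply/ler_addgt0Pr => e e0.
  pose s := Num.min T (e / (E + 1)).
  have s0 : 0 < s by rewrite lt_min T0 divr_gt0//; lra.
  have sT : s <= T by rewrite ge_min lexx.
  have se : s * E <= e.
    have : s <= e / (E + 1) by rewrite ge_min lexx orbT.
    by rewrite ler_pdivlMr; nra.
  have Ds : - (s * E) <= D s.
    have gi := weight_powRN_integrable w (ltW a0) (le_trans sT T1).
    have Js : J s <= phi 0 `^ (- (k + b)) * (s - 0).
      rewrite JE.
      apply: Rintegral_itv_le => //; first exact: ltW.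
      move=> z /andP[z0 zs]; apply: powRN_le => //; first exact: ltW.
      by rewrite weight_le// (lt_le_trans zs)// (le_trans sT).
    have Ps : U s `^ (- (k + b)) <= phi 0 `^ (- (k + b)).
      by apply: powRN_le => //; [exact: ltW | rewrite Uge// s0].
    have LU : 0 <= L s * U s `^ (- k).
      by rewrite LE mulr_ge0 ?powR_ge0// Rintegral_ge0// => z _; exact: powR_ge0.
    have h1 := ler_wpM2l K0 Js.
    have h2 := ler_wpM2l (mulr_ge0 lam0 (ltW s0)) Ps.
    by rewrite DE /E; lra.
  have : D s <= D T.
    pose Psi t := - U t `^ (- (k + b)).
    apply: (@increments_le _ D Psi (p `^ (- b)) s T sT) => u t su ut tT.
    have -> : Psi t - Psi u = U u `^ (- (k + b)) - U t `^ (- (k + b)).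
      by rewrite /Psi opprK addrC.
    by apply: incr => //; exact: lt_le_trans su.
  by lra.
have UT : 0 < U T by rewrite (lt_le_trans phi00)// Uge// T0 lexx.
have HT := H T; rewrite T0 lexx in HT; have {}HT := HT isT.
have UTE : U T `^ (- b) * U T `^ (- k) = U T `^ (- (k + b)).
  by rewrite -powRD ?(gt_eqF UT) ?implybT// opprD addrC.
have := ler_wpM2r (powR_ge0 (U T) (- k)) HT.
rewrite -(mulrA (c * T)) UTE.
by move: DT; rewrite DE; lra.
Qed.

End main_bound.

(** * The self-improving property *)

Section range.
Variable R : realType.
Variables (q M p0 : R).
Hypotheses (hq : 1 < q) (hM : 1 <= M) (hp0 : 1 < p0 < q)
  (hp0E : (q - p0) / (q - 1) * (M * p0) `^ (1 / (q - 1)) = 1).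
Local Notation mu := (@lebesgue_measure R).
Local Notation b := (1 / (q - 1)).
Local Notation c := (M `^ b).

(** The equation defining p0, solved for c. *)
Lemma critical_constE : c / (q - 1) = p0 `^ (- b) / (q - p0).
Proof.
have /andP[p01 p0q] := hp0.
move: hp0E; rewrite powRM ?(le_trans ler01)//; last by lra.
rewrite powRN => E.
have P0 : 0 < p0 `^ b by rewrite powR_gt0; lra.
have n1 : q - 1 != 0 by rewrite gt_eqF; lra.
have n2 : q - p0 != 0 by rewrite gt_eqF; lra.
have n3 : p0 `^ b != 0 by rewrite gt_eqF.
apply: (mulIf n2); apply: (mulIf n3).
by rewrite divfK// mulVf// -[RHS]E; field.
Qed.

(** At p, the tangent of x^-b at p0 is at most p^-b.  By the equation for p0, the
    line c (q - p)/(q - 1) meets this tangent at p = p0, and it has a smaller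
    slope. *)
Lemma Kprime_gt0 p : p0 < p <= q -> 0 < Kprime p q c.
Proof.
move=> /andP[p0p pq]; have /andP[p01 p0q] := hp0.
have b0 : 0 < b by rewrite divr_gt0//; lra.
have P0 : 0 < p0 by lra.
have pos : 0 < p by lra.
rewrite /Kprime mul1r -powRN.
have -> : c * ((q - p) / (q - 1)) = p0 `^ (- b) / (q - p0) * (q - p).
  by rewrite -critical_constE mulrA mulrAC.
have tang := powR_tangent (ltW b0) pos P0.
have Z0 : 0 < p0 `^ (- b) by rewrite powR_gt0.
rewrite subr_gt0; apply: lt_le_trans tang.
rewrite -mulrA ltr_pM2l// [_ * (q - p)]mulrC -subr_gt0.
have -> : 1 + b - b * (p / p0) - (q - p) / (q - p0) =
    (p - p0) * (q * (p0 - 1)) / ((q - 1) * (q - p0) * p0).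
  by field; rewrite !gt_eqF//; lra.
by rewrite divr_gt0// ?mulr_gt0//; lra.
Qed.

Lemma muckenhoupt_self_improvement phi t p : nondecreasing_weight phi ->
  muckenhoupt q M phi -> 0 < t <= 1 -> p0 < p <= q ->
  (muckenhoupt_product p phi t <=
      ((1 / Kprime p q c * c * (q / p) * ((p - 1) / (q - 1)) ^+ 2)
         `^ (p - 1))%:E)%E.
Proof.
move=> w muck t01 p0pq; have K0 := Kprime_gt0 p0pq.
have /andP[t0 t1] := t01; have /andP[p0p pq] := p0pq; have /andP[p01 p0q] := hp0.
have p1 : 1 < p by lra.
have M0 : 0 <= M := le_trans ler01 hM.
have b0 : 0 <= b by rewrite divr_ge0//; lra.
have c0 : 0 <= c := powR_ge0 _ _.
have q10 : 0 < q - 1 by lra.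
have p10 : 0 < p - 1 by lra.
have k0 : 0 <= 1 / (p - 1) - b.
  by rewrite subr_ge0 !mul1r lef_pV2 ?posrE// lerD2r.
have fi := muckenhoupt_integrable w hq muck t01.
have ap : (1 / (p - 1) - b + b) * (p - 1) = 1 by rewrite subrK divfK// gt_eqF.
have H s : 0 < s <= t -> \int[mu]_(y in `[0, s[) phi y `^ (- b) <=
    c * s * (s^-1 * \int[mu]_(y in `[0, s[) phi y) `^ (- b).
  move=> /andP[s0 st]; apply: muckenhoupt_mean_le => //.
  by rewrite s0 (le_trans st).
have KE : Kprime p q c = p `^ (- b) - c * ((1 / (p - 1) - b) / (1 / (p - 1) - b + b)).
  rewrite /Kprime mul1r powRN; congr (_ - _ * _).
  by field; rewrite !gt_eqF.
have := integral_powRN_bound w b0 k0 c0 p1 ap t01 fi H.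
rewrite /= -KE => /(_ (ltW K0)); rewrite subrK => bound.
have gi : mu.-integrable `[0, t[ (EFin \o (fun y => phi y `^ (- (1 / (p - 1))))).
  by apply: weight_powRN_integrable => //; rewrite divr_ge0// ltW.
rewrite muckenhoupt_productE// lee_fin.
have U0 := weight_mean_gt0 w t01 fi.
have J0 : 0 <= \int[mu]_(y in `[0, t[) phi y `^ (- (1 / (p - 1))).
  by apply: Rintegral_ge0 => z _; exact: powR_ge0.
move: bound U0 J0; set U := t^-1 * \int[mu]_(y in `[0, t[) phi y; set J := Rintegral _ _ _.
move: U J => U J bound U0 J0.
set B := _ * _ ^+ 2.
have pos : 0 < p by lra.
have qpos : 0 < q by lra.
have B0 : 0 <= B.
  have e1 : 0 <= 1 / Kprime p q c by rewrite divr_ge0// ltW.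
  have e2 : 0 <= q / p by rewrite divr_ge0 ?ltW.
  by rewrite /B mulr_ge0 ?sqr_ge0// mulr_ge0// mulr_ge0.
have JB : t^-1 * J <= B * U `^ (- (1 / (p - 1))).
  rewrite ler_pdivrMl//.
  have A0 := powR_ge0 U (- (1 / (p - 1))).
  move: A0 bound; set A := U `^ _ => A0 bound.
  suff : Kprime p q c * J <= Kprime p q c * (t * (B * A)) by rewrite ler_pM2l.
  apply: le_trans bound _.
  have tA : 0 <= t * A by rewrite mulr_ge0// ltW.
  rewrite (_ : _ * (t * (B * A)) = (Kprime p q c * B) * (t * A)); last by ring.
  apply: ler_wpM2r => //.
  rewrite -subr_ge0.
  (* The constant of integral_powRN_bound is smaller than K' B by a positive
     multiple of K'. *)
  suff -> : Kprime p q c * B - (c - (b * (p `^ (- b) / p) + (1 / (p - 1) - b) * c)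
      / (1 / (p - 1))) = Kprime p q c * ((p - 1) / (q - 1) / p).
    by rewrite mulr_ge0 ?divr_ge0// ltW.
  have -> : Kprime p q c * B = c * (q / p) * ((p - 1) / (q - 1)) ^+ 2.
    by rewrite /B; field; rewrite !gt_eqF.
  rewrite /Kprime mul1r -powRN.
  move: (p `^ (- b)) (c) => P C.
  by field; rewrite !gt_eqF.
have X0 : 0 <= t^-1 * J by rewrite mulr_ge0// invr_ge0 ltW.
have := @ge0_ler_powR _ (p - 1) (ltW p10) _ _ _ _ JB.
rewrite !nnegrE X0 mulr_ge0 ?powR_ge0// => /(_ isT isT).
rewrite (powRM _ B0 (powR_ge0 _ _)) -powRrM mulNr mul1r mulVf ?gt_eqF// powR_inv1 ?(ltW U0)//.
by rewrite ler_pdivlMr// (mulrC U).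
Qed.

End range.

(** * Truncated power weights *)

Section truncated_powers.
Variable R : realType.
Local Notation mu := (@lebesgue_measure R).

Lemma integral_derivative (f F : R -> R) (x y : R) : 0 < x -> x < y ->
  (forall z : R, 0 < z -> is_derive z 1 F (f z)) ->
  (forall z : R, 0 < z -> {for z, continuous f}) ->
  mu.-integrable `[x, y[ (EFin \o f) /\ \int[mu]_(z in `[x, y[) f z = F y - F x.
Proof.
move=> x0 xy dF cf.
have cfxy : {within `[x, y], continuous f}.
  apply: continuous_in_subspaceT => z; rewrite inE/= in_itv/= => /andP[xz _].
  by apply: cf; exact: lt_le_trans xz.
have fi : mu.-integrable `[x, y] (EFin \o f).
  by apply: continuous_compact_integrable => //; exact: segment_compact.
have fi' : mu.-integrable `[x, y[ (EFin \o f).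
  apply: integrableS fi => // z /=; rewrite !in_itv/= => /andP[-> zy].
  exact: ltW.
split=> //; rewrite Rintegral_itv_bndo_bndc// /Rintegral.
have cF (z : R) : 0 < z -> {for z, continuous F}.
  move=> z0; have [dz _] := dF z z0.
  by apply/differentiable_continuous; rewrite -derivable1_diffP.
rewrite (@continuous_FTC2 _ f F)//.
- split.
  + move=> z; rewrite in_itv/= => /andP[xz _].
    by have [] := dF z (lt_trans x0 xz).
  + exact/cvg_at_right_filter/cF.
  + exact/cvg_at_left_filter/cF/(lt_trans x0).
- move=> z; rewrite in_itv/= => /andP[xz _]; rewrite derive1E.
  by have [] := dF z (lt_trans x0 xz).
Qed.

Lemma continuous_powR (r z : R) : 0 < z -> {for z, continuous (fun x => x `^ r)}.
Proof.
move=> z0; apply/differentiable_continuous; rewrite -derivable1_diffP.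
by apply: derivable_powR; rewrite in_itv/= z0.
Qed.

Lemma integral_powR (r x y : R) : r + 1 != 0 -> 0 < x -> x < y ->
  mu.-integrable `[x, y[ (EFin \o (fun z => z `^ r)) /\
  \int[mu]_(z in `[x, y[) z `^ r = (y `^ (r + 1) - x `^ (r + 1)) / (r + 1).
Proof.
move=> r1 x0 xy; rewrite mulrBl.
apply: (@integral_derivative _ (fun z => z `^ (r + 1) / (r + 1))) => // z z0;
  last exact: continuous_powR.
have -> : z `^ r = (r + 1)^-1 *: ((r + 1) * z `^ (r + 1 - 1)).
  by rewrite addrK /GRing.scale/= mulrA mulVf// mul1r.
rewrite (_ : (fun _ => _) = (r + 1)^-1 *: (fun z => z `^ (r + 1))).
  by apply: is_deriveZ; exact: is_derive1_powR.
by apply/funext => u /=; rewrite mulrC.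
Qed.

Lemma integral_inv (x y : R) : 0 < x -> x < y ->
  mu.-integrable `[x, y[ (EFin \o (fun z => z^-1)) /\
  \int[mu]_(z in `[x, y[) z^-1 = ln y - ln x.
Proof.
move=> x0 xy; apply: integral_derivative => // z z0.
by apply: inv_continuous; rewrite gt_eqF.
Qed.

Lemma integral_max_powR (r e t : R) : r + 1 != 0 -> 0 < e -> e < t ->
  mu.-integrable `[0, t[ (EFin \o (fun z => Num.max z e `^ r)) ->
  \int[mu]_(z in `[0, t[) Num.max z e `^ r =
  (t `^ (r + 1) + r * e `^ (r + 1)) / (r + 1).
Proof.
move=> r1 e0 et fi; rewrite (Rintegral_itv_split (ltW e0) (ltW et) fi).
have -> : \int[mu]_(z in `[0, e[) Num.max z e `^ r = e `^ r * (e - 0).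
  apply: etrans (Rintegral_itv_cst (e `^ r) (ltW e0)); apply: eq_Rintegral => z.
  by rewrite inE/= in_itv/= => /andP[_ ze]; rewrite max_r// ltW.
have -> : \int[mu]_(z in `[e, t[) Num.max z e `^ r = \int[mu]_(z in `[e, t[) z `^ r.
  apply: eq_Rintegral => z.
  by rewrite inE/= in_itv/= => /andP[ze _]; rewrite max_l.
rewrite (integral_powR r1 e0 et).2 subr0 [e `^ (r + 1)]powRD ?(gt_eqF e0) ?implybT//.
by rewrite powRr1 ?(ltW e0)//; field.
Qed.

Lemma max_powR_weight (al e : R) : 0 <= al -> 0 < e ->
  nondecreasing_weight (fun y => Num.max y e `^ al).
Proof.
move=> al0 e0; have me y : 0 < Num.max y e by rewrite lt_max e0 orbT.
split=> [y _|x y _ _ xy]; first exact: powR_gt0.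
by rewrite ge0_ler_powR ?nnegrE ?(ltW (me _))// le_max2.
Qed.

Lemma max_powR_integrable (al e t : R) : 0 <= al -> 0 < e -> t <= 1 ->
  mu.-integrable `[0, t[ (EFin \o (fun y => Num.max y e `^ al)).
Proof.
move=> al0 e0 t1; apply: (@integrable_itv_sub _ _ 0 1) => //.
have w := max_powR_weight al0 e0.
apply: (@bounded_integrable _ _ _ _ (Num.max 1 e `^ al)).
  exact: weight_measurable w.
move=> z /andP[z0 z1]; rewrite ger0_norm ?powR_ge0//.
have me y : 0 < Num.max y e by rewrite lt_max e0 orbT.
by rewrite ge0_ler_powR ?nnegrE ?(ltW (me _))// le_max2// ltW.
Qed.

End truncated_powers.

(** * Optimality of the range of exponents *)

Section optimality.
Variable R : realType.
Variables (q M p0 : R).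
Hypotheses (hq : 1 < q) (hM : 1 <= M) (hp0 : 1 < p0 < q)
  (hp0E : (q - p0) / (q - 1) * (M * p0) `^ (1 / (q - 1)) = 1).
Local Notation mu := (@lebesgue_measure R).
Local Notation al := (p0 - 1).
Local Notation g := ((p0 - 1) / (q - 1)).

(** The q-constant of the weight y^(p0-1) is 1 / (p0 (1-g)^(q-1)). *)
Lemma critical_power_const : (1 - g) `^ (q - 1) * p0 * M = 1.
Proof.
have /andP[p01 p0q] := hp0; have q10 : q - 1 != 0 by rewrite gt_eqF; lra.
have M0 : 0 <= M := le_trans ler01 hM.
have E : 1 - g = (q - p0) / (q - 1) by field.
have := congr1 (fun z => z `^ (q - 1)) hp0E; rewrite powR1 powRM ?powR_ge0 -?E //=; last first.
  by rewrite E divr_ge0//; lra.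
rewrite -powRrM mul1r mulVf// powRr1; last by rewrite mulr_ge0//; lra.
by rewrite (mulrC M) mulrA.
Qed.

Lemma max_powR_muckenhoupt e : 0 < e ->
  muckenhoupt q M (fun y => Num.max y e `^ al).
Proof.
move=> e0 t /andP[t0 t1].
have /andP[p01 p0q] := hp0.
have q10 : 0 < q - 1 by lra.
have al0 : 0 <= al by lra.
have w := max_powR_weight al0 e0.
have b0 : 0 <= 1 / (q - 1) by rewrite divr_ge0// ltW.
have fi := max_powR_integrable al0 e0 t1.
have hi := weight_powRN_integrable w b0 t1.
rewrite muckenhoupt_productE// lee_fin.
have [te|et] := leP t e.
  have -> : \int[mu]_(y in `[0, t[) Num.max y e `^ al = e `^ al * (t - 0).
    apply: etrans (Rintegral_itv_cst (e `^ al) (ltW t0)); apply: eq_Rintegral => z.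
    by rewrite inE/= in_itv/= => /andP[_ zt]; rewrite max_r// ltW// (lt_le_trans zt).
  have -> : \int[mu]_(y in `[0, t[) (Num.max y e `^ al) `^ (- (1 / (q - 1))) =
      (e `^ al) `^ (- (1 / (q - 1))) * (t - 0).
    apply: etrans (Rintegral_itv_cst _ (ltW t0)); apply: eq_Rintegral => z.
    by rewrite inE/= in_itv/= => /andP[_ zt]; rewrite max_r// ltW// (lt_le_trans zt).
  have tV z : t^-1 * (z * (t - 0)) = z by field; rewrite gt_eqF.
  rewrite !tV -powRrM mulNr mul1r mulVf ?gt_eqF// powR_inv1 ?powR_ge0// mulfV//.
  by rewrite gt_eqF// powR_gt0.
have g1 : g < 1 by rewrite ltr_pdivrMr//; lra.
have g1' : 0 < - g + 1 by rewrite addrC subr_gt0.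
rewrite integral_max_powR//; last by rewrite subrK gt_eqF; lra.
have hE : (fun y => (Num.max y e `^ al) `^ (- (1 / (q - 1)))) =
    (fun y => Num.max y e `^ (- g)).
  by apply/funext => y; rewrite -powRrM mulrN mul1r.
rewrite hE in hi *.
rewrite integral_max_powR// ?gt_eqF//.
pose u := e / t.
have u0 : 0 < u by rewrite divr_gt0.
have u1 : u <= 1 by rewrite ler_pdivrMr// mul1r ltW.
have eE r : e `^ r = u `^ r * t `^ r by rewrite -powRM ?(ltW u0) ?(ltW t0)// divfK ?gt_eqF.
have tN r : t `^ (r + 1) = t `^ r * t.
  by rewrite powRD ?(gt_eqF t0) ?implybT// powRr1// ltW.
rewrite !eE !tN.
have -> : t^-1 * ((t `^ al * t + al * (u `^ (al + 1) * (t `^ al * t))) / (al + 1)) =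
    t `^ al * ((1 + al * u `^ (al + 1)) / p0).
  by rewrite subrK; field; rewrite !gt_eqF//; lra.
have -> : t^-1 * ((t `^ (- g) * t + - g * (u `^ (- g + 1) * (t `^ (- g) * t))) / (- g + 1)) =
    t `^ (- g) * ((1 - g * u `^ (1 - g)) / (1 - g)).
  rewrite (addrC (- g) 1); move: g1'; rewrite (addrC (- g) 1).
  move: (u `^ (1 - g)) (t `^ (- g)) (g) => x y z z1.
  by field; rewrite !gt_eqF.
have := truncation_factor_le1 hq al0 _ (introT andP (conj u0 u1)).
have alq : al < q - 1 by lra.
move=> /(_ alq).
have gy : 0 <= 1 - g * u `^ (1 - g).
  have y1 : u `^ (1 - g) <= 1.
    by rewrite -[leRHS](powRr0 u) ger_powR ?u0 ?u1//; lra.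
  have g0 : 0 <= g by rewrite divr_ge0// ltW.
  by rewrite subr_ge0 mulr_ile1 ?powR_ge0// ltW.
have g10 : 0 <= (1 - g)^-1 by rewrite invr_ge0; lra.
rewrite powRM ?powR_ge0 ?mulr_ge0// -powRrM mulNr divfK ?gt_eqF//.
rewrite powRN (powRM _ gy g10).
rewrite -(powR_inv1 (_ : 0 <= 1 - g)); last by lra.
rewrite -powRrM mulN1r powRN.
have := critical_power_const.
have tal : t `^ al != 0 by rewrite gt_eqF// powR_gt0.
have G0 : (1 - g) `^ (q - 1) != 0 by rewrite gt_eqF// powR_gt0; lra.
have M0 : 0 < M := lt_le_trans ltr01 hM.
move: tal G0; move: ((1 - g * _) `^ (q - 1)) ((1 - g) `^ (q - 1)) (t `^ al) => Y G tt tal G0 ME.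
move: (1 + al * u `^ (al + 1)) => X XY.
have P0 : p0 != 0 by rewrite gt_eqF; lra.
have -> : tt * (X / p0) * (tt^-1 * (Y / G)) = X * Y * M.
  have -> : M = (G * p0)^-1.
    by apply: (mulfI (mulf_neq0 G0 P0)); rewrite mulfV ?mulf_neq0.
  by field; rewrite tal G0 P0.
by rewrite -[leRHS]mul1r ler_wpM2r// ltW.
Qed.

(** At t = 1 the mean of the weight is at least 1/p0, while the integral of its
    power -1/(p-1) is at least that of 1/y over [e, 1[, i.e. - ln e = N.  The
    choice of N makes N^(p-1) / p0 = |C| + 1. *)
Lemma max_powR_not_muckenhoupt p C : 1 < p <= p0 ->
  exists2 e, 0 < e & ~ muckenhoupt p C (fun y => Num.max y e `^ al).
Proof.
move=> /andP[p1 pp0]; have /andP[p01 p0q] := hp0.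
have p10 : 0 < p - 1 by lra.
have al0 : 0 <= al by lra.
have a0 : 0 <= 1 / (p - 1) by rewrite divr_ge0// ltW.
pose N := (p0 * (`|C| + 1)) `^ (1 / (p - 1)).
have P0 : 0 < p0 by lra.
have NC : 0 < p0 * (`|C| + 1) by rewrite mulr_gt0// ltr_wpDl.
have N0 : 0 < N by rewrite powR_gt0.
pose e := expR (- N).
have e0 : 0 < e := expR_gt0 _.
have e1 : e < 1 by rewrite expR_lt1 oppr_lt0.
exists e => // /(_ 1); rewrite ltr01 lexx => /(_ isT).
have fi := max_powR_integrable al0 e0 (lexx 1).
have w := max_powR_weight al0 e0.
have hi := weight_powRN_integrable w a0 (lexx 1).
have U1 : p0^-1 <= \int[mu]_(y in `[0, 1[) Num.max y e `^ al.
  rewrite integral_max_powR// subrK; last by rewrite gt_eqF; lra.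
  rewrite powR1 -[leLHS]mul1r ler_wpM2r ?invr_ge0//; first by lra.
  by rewrite lerDl mulr_ge0 ?powR_ge0.
have J1 : N <= \int[mu]_(y in `[0, 1[) (Num.max y e `^ al) `^ (- (1 / (p - 1))).
  have [ii iE] := integral_inv e0 e1.
  rewrite (Rintegral_itv_split (ltW e0) (ltW e1) hi).
  have NE : N = \int[mu]_(y in `[e, 1[) y^-1 by rewrite iE ln1 /e expRK sub0r opprK.
  rewrite NE; apply: ler_wpDl.
    by apply: Rintegral_ge0 => z _; exact: powR_ge0.
  apply: le_Rintegral => //.
    by apply: integrable_itv_sub hi => //; exact: ltW.
  move=> z /=; rewrite in_itv/= => /andP[ez z1].
  have z0 := lt_le_trans e0 ez.
  rewrite max_l// -powRrM -powR_inv1 ?(ltW z0)// ger_powR ?z0 ?(ltW z1)//.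
  by rewrite mulrN lerN2 mulrA mulr1 ler_pdivlMr// mul1r lerD2r.
rewrite muckenhoupt_productE// lee_fin invr1.
move: U1 J1; set U := Rintegral _ _ _; set J := Rintegral _ _ _.
move: U J => U J U1 J1; rewrite !mul1r; apply/negP; rewrite -ltNge.
have NJ : N `^ (p - 1) <= J `^ (p - 1).
  by rewrite ge0_ler_powR ?nnegrE ?(ltW N0) ?(ltW p10) ?(le_trans (ltW N0))//.
have NE : N `^ (p - 1) = p0 * (`|C| + 1).
  by rewrite /N -powRrM divfK ?gt_eqF// powRr1// ltW.
have p0V : 0 <= p0^-1 by rewrite invr_ge0 ltW.
have := ler_pM p0V (powR_ge0 N (p - 1)) U1 NJ.
rewrite NE mulKf ?gt_eqF//; apply: lt_le_trans.
by rewrite (le_lt_trans (ler_norm C))// ltrDl.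
Qed.

End optimality.

(* The second conjunct is the optimality of the range p0 < p <= q.  It is
   uniform over weights: as phi 0 > 0 bounds phi from below on [0, 1[, each
   single phi satisfies the p-condition with some constant depending on phi. *)
Theorem mainTheorem4 (R : realType) (q M p0 : R) (hq : 1 < q) (hM : 1 <= M)
    (hp0 : 1 < p0 < q)
    (hp0E : (q - p0) / (q - 1) * (M * p0) `^ (1 / (q - 1)) = 1) :
  (forall phi : R -> R, nondecreasing_weight phi -> muckenhoupt q M phi ->
    forall t p : R, 0 < t <= 1 -> p0 < p <= q ->
    let c := M `^ (1 / (q - 1)) in
    (muckenhoupt_product p phi t <=
      ((1 / Kprime p q c * c * (q / p) * ((p - 1) / (q - 1)) ^+ 2)
         `^ (p - 1))%:E)%E) /\
  (forall p : R, 1 < p <= p0 -> forall C : R,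
    exists phi : R -> R, [/\ nondecreasing_weight phi, muckenhoupt q M phi &
      ~ muckenhoupt p C phi]).
Proof.
split=> [phi w muck t p t01 p0pq|p p1p0 C].
  exact: (muckenhoupt_self_improvement hq hM hp0 hp0E).
have [e e0 notAp] := max_powR_not_muckenhoupt hp0 C p1p0.
exists (fun y => Num.max y e `^ (p0 - 1)); split => //.
  by apply: max_powR_weight => //; rewrite subr_ge0; case/andP: hp0 => /ltW.
exact: max_powR_muckenhoupt hq hM hp0 hp0E _ e0.
Qed.
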